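(* For every integer $n\ge 0$, $$\sum_{j=1}^{n+1}\mathcal T_{n,j}=2^{n}.$$
   Context: Define $\psi:\{1,2,3,\dots\}\to\{0,1,2,\dots\}$ by $\psi(1)=0$, $\psi(2)=1$, $\psi(3)=2$ and $\psi(j)=\sum_{k=1}^{j-1}\psi(k)$ for $j\ge 4$. The triangular array $\mathcal T=(\mathcal T_{n,j})$, $n\ge 0$, $1\le j\le n+1$, of integers is defined recursively by: $\mathcal T_{n,n+1}=1$ for every $n\ge 0$; $\mathcal T_{1,1}=1$, $\mathcal T_{2,2}=2$, $\mathcal T_{3,3}=3$; $\mathcal T_{n,n}=\sum_{k=1}^{n-2}\mathcal T_{n-k,n-k}$ for every $n\ge 4$; and $\mathcal T_{n,j}=\mathcal T_{n-1,j}+\psi(j)$ for every $n\ge 2$ and $1\le j\le n-1$. *)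

(* Defs.v *)
From mathcomp Require Import all_boot all_order all_algebra.

Set Implicit Arguments.
Unset Strict Implicit.
Unset Printing Implicit Defensive.

Import GRing.Theory.
Local Open Scope ring_scope.

(* The recursions for psi and for the diagonal entries refer to all earlier
   values, so each is computed through the list of its values at 1, ..., n
   (in this order). The lemmas below are the defining equations. *)
Fixpoint psi_seq (n : nat) : seq nat :=
  if n is m.+1 then
    let s := psi_seq m in
    rcons s (match m with 0 => 0 | 1 => 1 | 2 => 2 | _ => sumn s end)%N
  else [::].

(* Only the values at j >= 1 are meaningful. *)
Definition psi (j : nat) : nat := last 0%N (psi_seq j).

Fixpoint diag_seq (n : nat) : seq int :=
  if n is m.+1 then
    let s := diag_seq m in
    rcons s (match m with
             | 0 => 1 | 1 => 2 | 2 => 3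
             | _ => \sum_(x <- behead s) x
             end)
  else [::].

Definition diag (n : nat) : int := last 0 (diag_seq n).

(* Only the values with 1 <= j <= n + 1 are meaningful. *)
Fixpoint triT (n j : nat) : int :=
  if j == n.+1 then 1
  else if n is m.+1 then
    if j == n then diag n else triT m j + (psi j)%:Z
  else 0.

Lemma psi1 : psi 1 = 0%N. Proof. by []. Qed.
Lemma psi2 : psi 2 = 1%N. Proof. by []. Qed.
Lemma psi3 : psi 3 = 2%N. Proof. by []. Qed.

Lemma psi_seqE n : psi_seq n = [seq psi k | k <- iota 1 n].
Proof.
elim: n => [//|n IHn].
rewrite -[X in iota 1 X]addn1 iotaD map_cat -IHn add1n cats1.
by rewrite /psi /= last_rcons.
Qed.

Lemma psi_rec j : (4 <= j)%N -> psi j = (\sum_(1 <= k < j) psi k)%N.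
Proof.
case: j => [|[|[|[|j]]]] // _.
by rewrite {1}/psi [psi_seq _]/= last_rcons -/(psi_seq j.+3) psi_seqE
  sumnE big_map.
Qed.

Lemma diag_seqE n : diag_seq n = [seq diag k | k <- iota 1 n].
Proof.
elim: n => [//|n IHn].
rewrite -[X in iota 1 X]addn1 iotaD map_cat -IHn add1n cats1.
by rewrite /diag /= last_rcons.
Qed.

Lemma triTS n j : triT n.+1 j =
  if j == n.+2 then 1
  else if j == n.+1 then diag n.+1 else triT n j + (psi j)%:Z.
Proof. by []. Qed.

Lemma triT_last n : triT n n.+1 = 1.
Proof. by case: n => [//|n]; rewrite triTS eqxx. Qed.

Lemma triT_diag n : (1 <= n)%N -> triT n n = diag n.
Proof. by case: n => [//|n] _; rewrite triTS ltn_eqF // eqxx. Qed.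

Lemma triT11 : triT 1 1 = 1. Proof. by []. Qed.
Lemma triT22 : triT 2 2 = 2. Proof. by []. Qed.
Lemma triT33 : triT 3 3 = 3. Proof. by []. Qed.

Lemma triT_diag_rec n : (4 <= n)%N ->
  triT n n = \sum_(1 <= k < n.-1) triT (n - k) (n - k).
Proof.
case: n => [|[|[|[|n]]]] // _.
rewrite triT_diag // {1}/diag [diag_seq _]/= last_rcons -/(diag_seq n.+3).
rewrite diag_seqE /index_iota subSS subn0 /= -[_ :: _ :: _]/(map diag (iota 2 n.+2)).
rewrite big_map -[iota 2 n.+2]/(index_iota 2 n.+4) big_nat_rev.
rewrite (big_addn 1 _ 1) subn1; apply: eq_big_nat => i /andP[i1 i2].
have -> : (2 + n.+4 - (i + 1).+1 = n.+4 - i)%N by rewrite addn1 !addSn !subSS.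
by rewrite triT_diag // subn_gt0 ltnW.
Qed.

Lemma triT_rec n j : (2 <= n)%N -> (1 <= j <= n.-1)%N ->
  triT n j = triT n.-1 j + (psi j)%:Z.
Proof.
case: n => [//|n] _ /andP[_ jn]; rewrite triTS !ltn_eqF // !ltnS //.
exact: leqW.
Qed.

(* Main.v *)
Require Import Defs.
From mathcomp Require Import all_boot all_order all_algebra.
From mathcomp Require Import ring.

Import GRing.Theory.

Local Open Scope ring_scope.

(** Write [S n] for the [n]-th row sum. Passing from row [n] to row [n.+1]
    replaces the final entry 1 of row [n] by the diagonal entry [diag n.+1],
    adds [psi j] to each of the earlier entries, and appends a new final 1.
    Hence [S n.+1 = S n + (diag n.+1 + \sum_(1 <= j < n.+1) psi j)], and it
    remains to see that the increment is [2 ^+ n].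

    From index 4 on, both [psi] and [diag] are the sum of their predecessors
    (from index 1 and from index 2, respectively), so both partial sums double
    at each step. They start at [0 + 1 + 2 = 3] and [2 + 3 = 5], so the
    increment at index [n + 4] is [5 * 2 ^+ n + 3 * 2 ^+ n = 2 ^+ (n + 3)]. *)

Lemma sum_psi n : (\sum_(1 <= k < n.+4) psi k = 3 * 2 ^ n)%N.
Proof.
elim: n => [|n IHn]; first by rewrite unlock.
by rewrite big_nat_recr //= psi_rec // IHn expnS mulnCA mul2n addnn.
Qed.

(** The recursion for the diagonal, read in increasing order of the index:
    this is the form in which the doubling of the partial sums is visible. *)
Lemma diag_rec n : diag n.+4 = \sum_(2 <= k < n.+4) diag k.
Proof.
rewrite -triT_diag // triT_diag_rec // [RHS]big_nat_rev (big_addn 1 _ 1) subn1.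
apply: eq_big_nat => i /andP[_ lt_i].
by rewrite triT_diag ?subn_gt0 1?ltnW // addn1 !addSn !subSS.
Qed.

Lemma sum_diag n : \sum_(2 <= k < n.+4) diag k = 5 * 2 ^+ n.
Proof.
elim: n => [|n IHn]; first by rewrite unlock.
by rewrite big_nat_recr //= diag_rec IHn exprS; ring.
Qed.

(** The increment of the row sums; the indices below 4, where the recursions
    do not apply yet, are checked by evaluation. *)
Lemma diag_add_sum_psi n :
  diag n.+1 + (\sum_(1 <= j < n.+1) psi j)%N%:Z = 2 ^+ n.
Proof.
case: n => [|[|[|n]]]; try by rewrite unlock.
by rewrite diag_rec sum_diag sum_psi -natz natrM natrX !exprS; ring.
Qed.

Lemma row_sumS n :
  \sum_(1 <= j < n.+3) triT n.+1 j =
  \sum_(1 <= j < n.+2) triT n j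
    + (diag n.+1 + (\sum_(1 <= j < n.+1) psi j)%N%:Z).
Proof.
rewrite big_nat_recr // big_nat_recr // [in RHS]big_nat_recr //.
rewrite !triT_last triT_diag //.
have -> : \sum_(1 <= j < n.+1) triT n.+1 j =
    \sum_(1 <= j < n.+1) triT n j + (\sum_(1 <= j < n.+1) psi j)%N%:Z.
  rewrite -natz natr_sum -big_split; apply: eq_big_nat => j /andP[j_gt0 lt_j].
  rewrite natz triT_rec ?j_gt0 //.
  exact: leq_ltn_trans j_gt0 lt_j.
by rewrite /=; ring.
Qed.

Theorem proposition2p11 (n : nat) :
  \sum_(1 <= j < n.+2) triT n j = 2 ^+ n.
Proof.
elim: n => [|n IHn]; first by rewrite big_nat1.
by rewrite row_sumS IHn diag_add_sum_psi exprS mulr_natl mulr2n.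
Qed.
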